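(* Assume $f:\mathfrak A\subset\mathbb R\to\mathfrak B\subset\mathbb R$ is analytic and let $A$ be an $n\times n$ matrix. Then: (1) $f(\mathcal R_r(A))=\mathcal R(f(\mathcal R_c(A)))$; (2) $f(\mathcal R_c(A))=\mathcal R(f(\mathcal R_r(A)))$; (3) $f(\mathcal R(A))=\mathcal R(f(A))$.
   Context: Matrices have entries in a field $\mathbb K$ of characteristic zero. For an $n\times n$ matrix $A=(a_{ij})$: $\mathcal R_r(A)=(a_{i(n+1-j)})$ (reversing by rows), $\mathcal R_c(A)=(a_{(n+1-i)j})$ (reversing by columns), $\mathcal R(A)=(a_{(n+1-i)(n+1-j)})$ (reversing). For $f$ analytic with power series coefficients $a_k$ and a square matrix $B$, $f(B)=\sum_{k=0}^\infty a_kB^k$. *)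

(* Defs.v *)
From HB Require Import structures.
From mathcomp Require Import all_boot all_order all_algebra.
From mathcomp Require Import all_classical all_reals all_analysis.

Set Implicit Arguments.
Unset Strict Implicit.
Unset Printing Implicit Defensive.

Import Order.TTheory GRing.Theory Num.Theory.
Import numFieldNormedType.Exports.

Local Open Scope classical_set_scope.
Local Open Scope ring_scope.

(* [rev_ord] is j |-> n - 1 - j on 'I_n, i.e. j |-> n + 1 - j on 1..n. *)
Definition reverse_rows (K : Type) (n : nat) (A : 'M[K]_n) : 'M[K]_n :=
  \matrix_(i, j) A i (rev_ord j).

Definition reverse_cols (K : Type) (n : nat) (A : 'M[K]_n) : 'M[K]_n :=
  \matrix_(i, j) A (rev_ord i) j.

Definition reverse_mx (K : Type) (n : nat) (A : 'M[K]_n) : 'M[K]_n :=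
  \matrix_(i, j) A (rev_ord i) (rev_ord j).

Definition has_power_series (R : realType) (f : R -> R) (x0 : R)
    (a : nat -> R) : Prop :=
  \forall x \near x0, pseries a (x - x0) @ \oo --> f x.

(* Only the values of f on U matter, since U is open. *)
Definition analytic_on (R : realType) (U : set R) (f : R -> R) : Prop :=
  open U /\ forall x0, U x0 -> exists a, has_power_series f x0 a.

(* The coefficients of the expansion of f at 0; they are unique when an
   expansion exists, and the default value 0 is used when there is none. *)
Definition power_series_coef (R : realType) (f : R -> R) : nat -> R :=
  xget (fun=> 0) [set a | has_power_series f 0 a].

(* Partial sums of \sum_k a_k B^k.  The real coefficients a_k and the entries
   of B, which lie in an arbitrary field K, are both sent to a field L whose
   norm gives a meaning to convergence, here entrywise. *)
Definition mxfun_series (R : realType) (K : fieldType) (L : numFieldType)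
    (iota : {rmorphism R -> L}) (phi : {rmorphism K -> L}) (f : R -> R)
    (n : nat) (B : 'M[K]_n) : nat -> 'M[L]_n :=
  series (fun k => iota (power_series_coef f k) *: map_mx phi B ^+ k).

Definition mxfun_defined (R : realType) (K : fieldType) (L : numFieldType)
    (iota : {rmorphism R -> L}) (phi : {rmorphism K -> L}) (f : R -> R)
    (n : nat) (B : 'M[K]_n) : Prop :=
  cvg (mxfun_series iota phi f B @ \oo).

Definition mxfun (R : realType) (K : fieldType) (L : numFieldType)
    (iota : {rmorphism R -> L}) (phi : {rmorphism K -> L}) (f : R -> R)
    (n : nat) (B : 'M[K]_n) : 'M[L]_n :=
  lim (mxfun_series iota phi f B @ \oo).

(* Main.v *)
(* Reversing a matrix is conjugation by the exchange permutation matrix, hence a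
   ring automorphism; being also linear and continuous, it commutes with every
   partial sum of the series and with the limit. Reversing rows and reversing
   columns are exchanged by it, so (1) and (2) are instances of (3). *)
Require Import Defs.
From mathcomp Require Import all_boot all_order all_algebra.
From mathcomp Require Import all_classical all_reals all_analysis.

Import Order.TTheory GRing.Theory Num.Theory.
Import numFieldNormedType.Exports.

Local Open Scope classical_set_scope.
Local Open Scope ring_scope.

Lemma reverse_mxK (K : Type) (n : nat) :
  involutive (@reverse_mx K n).
Proof. by move=> A; apply/matrixP => i j; rewrite !mxE !rev_ordK. Qed.

Lemma reverse_mx_cols (K : Type) (n : nat) (A : 'M[K]_n) :
  reverse_mx (reverse_cols A) = reverse_rows A.
Proof. by apply/matrixP => i j; rewrite !mxE rev_ordK. Qed.

Lemma map_reverse_mx (K L : Type) (g : K -> L) (n : nat) (A : 'M[K]_n) :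
  map_mx g (reverse_mx A) = reverse_mx (map_mx g A).
Proof. by apply/matrixP => i j; rewrite !mxE. Qed.

(** The identity matrix is fixed since [rev_ord] is injective. In a product, the reversed summation
    index occurs in both factors, so substituting [rev_ord l] for [l] undoes it and leaves only the
    outer indices reversed. *)
Lemma reverse_mxX (L : pzRingType) (n : nat) (A : 'M[L]_n) (k : nat) :
  reverse_mx A ^+ k = reverse_mx (A ^+ k).
Proof.
elim: k => [|k IHk].
  by apply/matrixP => i j; rewrite !expr0 !mxE (inj_eq rev_ord_inj).
rewrite !exprS IHk; apply/matrixP => i j.
rewrite [LHS]mxE [RHS]mxE [RHS]mxE (reindex_inj rev_ord_inj) /=.
by apply: eq_bigr => l _; rewrite !mxE rev_ordK.
Qed.

Lemma reverse_mx_continuous (T : topologicalType) (n : nat) :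
  continuous (@reverse_mx T n).
Proof.
move=> M B [P MP sPB].
(* [P] is a box inside [B], one neighbourhood per entry. Reversal only permutes the entries, so the
   preimage of the box is the box with both indices reversed. *)
exists (fun i j => P (rev_ord i) (rev_ord j)) => [i j|N NP].
  by have := MP (rev_ord i) (rev_ord j); rewrite mxE !rev_ordK.
by apply: sPB => i j; have := NP (rev_ord i) (rev_ord j); rewrite mxE !rev_ordK.
Qed.

Section ReverseSeries.
Variables (R : realType) (K : fieldType) (L : numFieldType).
Variables (iota : {rmorphism R -> L}) (phi : {rmorphism K -> L}) (f : R -> R).
Variables (n : nat).
Implicit Types B : 'M[K]_n.

Lemma mxfun_series_reverse_mx B :
  mxfun_series iota phi f (reverse_mx B) =
  @reverse_mx L n \o mxfun_series iota phi f B.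
Proof.
apply/funext => m; apply/matrixP => i j.
rewrite /mxfun_series /series /= mxE !summxE; apply: eq_bigr => k _.
by rewrite map_reverse_mx reverse_mxX !mxE.
Qed.

Lemma cvg_mxfun_series_reverse_mx B (M : 'M[L]_n) :
  mxfun_series iota phi f B @ \oo --> M ->
  mxfun_series iota phi f (reverse_mx B) @ \oo --> reverse_mx M.
Proof.
rewrite mxfun_series_reverse_mx => BM.
by apply: continuous_cvg BM; exact: reverse_mx_continuous.
Qed.

Lemma mxfun_defined_reverse_mx B :
  mxfun_defined iota phi f (reverse_mx B) <-> mxfun_defined iota phi f B.
Proof.
(* One implication for every [C] is enough: the converse is the case [C := reverse_mx B], as
   reversal is an involution. *)
suff dB (C : 'M[K]_n) : mxfun_defined iota phi f C ->
    mxfun_defined iota phi f (reverse_mx C).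
  by split=> [/dB|/dB//]; rewrite reverse_mxK.
by move=> /cvg_mxfun_series_reverse_mx /cvgP.
Qed.

(** Convergence makes [mxfun] a true limit rather than the default value of [lim]; limits of
    matrices are unique because the norm topology is Hausdorff. *)
Lemma mxfun_reverse_mx B : mxfun_defined iota phi f B ->
  mxfun iota phi f (reverse_mx B) = reverse_mx (mxfun iota phi f B).
Proof.
move=> /cvg_mxfun_series_reverse_mx; apply: cvg_lim.
exact: norm_hausdorff.
Qed.

End ReverseSeries.

Theorem theorem2p25 (R : realType)
  (K : fieldType) (charK0 : [pchar K] =i pred0)
  (L : numFieldType) (iota : {rmorphism R -> L}) (phi : {rmorphism K -> L})
  (U V : set R) (f : R -> R)
  (f_maps : forall x : R, U x -> V (f x))
  (f_analytic : analytic_on U f) (U0 : U 0)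
  (n : nat) (A : 'M[K]_n) :
  [/\ (mxfun_defined iota phi f (reverse_rows A) <->
         mxfun_defined iota phi f (reverse_cols A)) /\
      (mxfun_defined iota phi f (reverse_cols A) ->
         mxfun iota phi f (reverse_rows A) =
           reverse_mx (mxfun iota phi f (reverse_cols A))),
      (mxfun_defined iota phi f (reverse_cols A) <->
         mxfun_defined iota phi f (reverse_rows A)) /\
      (mxfun_defined iota phi f (reverse_rows A) ->
         mxfun iota phi f (reverse_cols A) =
           reverse_mx (mxfun iota phi f (reverse_rows A)))
    & (mxfun_defined iota phi f (reverse_mx A) <->
         mxfun_defined iota phi f A) /\
      (mxfun_defined iota phi f A ->
         mxfun iota phi f (reverse_mx A) =
           reverse_mx (mxfun iota phi f A))].
Proof.
(* With [reverse_mx_cols], each one-sided reversal is the full reversal of the other, so (1) and (2)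
   are (3) at [reverse_cols A] and [reverse_rows A]. *)
have colsE : reverse_cols A = reverse_mx (reverse_rows A).
  by rewrite -reverse_mx_cols reverse_mxK.
split; split.
- by rewrite -reverse_mx_cols; exact: mxfun_defined_reverse_mx.
- by rewrite -reverse_mx_cols; exact: mxfun_reverse_mx.
- by rewrite colsE; exact: mxfun_defined_reverse_mx.
- by rewrite colsE; exact: mxfun_reverse_mx.
- exact: mxfun_defined_reverse_mx.
- exact: mxfun_reverse_mx.
Qed.
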